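(* Let $n\ge 3$ and let $P\subset\mathbb R^n$ be a polytope with $rB_2^n\subset P$ for some $r$ with $\frac{3\sqrt3}{\sqrt n}\le r\le 1$. Let $N=N(P,B_2^n)$ and let $\mathcal F$ be the set of facets of $P$. If $3\le N< e^{n/8}$, then \[ |\mathcal F|>\left(\frac{1}{2\left(1-r\sqrt{1-\frac{4\log N}{n}}\right)}\right)^{\frac{n-1}{2}}. \]
   Context: $B_2^n$ is the closed Euclidean unit ball in $\mathbb R^n$ centered at $0$. A polytope is the convex hull of finitely many points; a facet is an $(n-1)$-dimensional face. For convex bodies $K,T$, the covering number is $N(K,T)=\min\{N:\exists x_1,\dots,x_N\in\mathbb R^n,\ K\subset\bigcup_{i=1}^N(x_i+T)\}$. $\log$ is the natural logarithm. *)

(* Defs.v *)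
From HB Require Import structures.
From mathcomp Require Import all_boot all_order all_algebra.
From mathcomp Require Import all_classical all_reals all_analysis.
Set Implicit Arguments. Unset Strict Implicit. Unset Printing Implicit Defensive.
Import Order.TTheory GRing.Theory Num.Theory.
Local Open Scope classical_set_scope.
Local Open Scope ring_scope.

Section Defs.
Variables (R : realType) (n : nat).

Definition dotv (u v : 'rV[R]_n) : R := \sum_(i < n) u ord0 i * v ord0 i.
Definition enorm (u : 'rV[R]_n) : R := Num.sqrt (dotv u u).

Definition unit_ball : set 'rV[R]_n := [set x | enorm x <= 1].

Definition conv_hull (m : nat) (V : 'I_m -> 'rV[R]_n) : set 'rV[R]_n :=
  [set x | exists w : 'I_m -> R, (forall i, 0 <= w i) /\
     \sum_(i < m) w i = 1 /\ x = \sum_(i < m) w i *: V i].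

Definition is_polytope (P : set 'rV[R]_n) : Prop :=
  exists (m : nat) (V : 'I_m -> 'rV[R]_n), P = conv_hull V.

Definition aff_indep_n (x0 : 'rV[R]_n) (y : 'I_n.-1 -> 'rV[R]_n) : bool :=
  row_free (\matrix_(i < n.-1) (y i - x0)).

Definition is_facet (P F : set 'rV[R]_n) : Prop :=
  exists (a : 'rV[R]_n) (b : R),
    [/\ a != 0,
        (forall x, P x -> dotv a x <= b),
        F = [set x | P x /\ dotv a x = b] &
        exists (x0 : 'rV[R]_n) (y : 'I_n.-1 -> 'rV[R]_n),
          [/\ F x0, (forall i, F (y i)) & aff_indep_n x0 y]].

Definition covered_by (K T : set 'rV[R]_n) (N : nat) : Prop :=
  exists x : 'I_N -> 'rV[R]_n, K `<=` \bigcup_(i in [set: 'I_N]) [set x i + t | t in T].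

Definition is_covering_number (K T : set 'rV[R]_n) (N : nat) : Prop :=
  covered_by K T N /\ (forall M, covered_by K T M -> (N <= M)%N).

Definition more_facets_than (P : set 'rV[R]_n) (c : R) : Prop :=
  exists (k : nat) (F : 'I_k -> set 'rV[R]_n),
    [/\ injective F, (forall i, is_facet P (F i)) & c < k%:R].
End Defs.

(* Main.v *)
(* The facet normals that matter are the vertices [a] of the polar of [P]; they satisfy [|a| <= 1/r],
   and the ray through [x] leaves [P] through the facet of a vertex maximizing [<a, x>]. Put
   [L = ln N] and [t^2 = 4L/n]. If [x] makes an angle of cosine less than [t] with every center of
   the covering, the points of [P] on its ray have norm at most [(1 - t^2)^(-1/2)], so [x] lies in the
   cap of height [alpha = r (1 - t^2)^(1/2)] around the normal of one of the facets. Hence the [K]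
   caps of height [alpha] and the [N] caps of height [t] cover the sphere.

   Caps are measured with even moments: [E <x, u>^(2k) / alpha^(2k)] bounds twice the measure of a
   cap of height [alpha]. For a suitable [j] the [N] caps around the centers contribute at most [2/3]
   to the total [2]; for a suitable [k] a cap of height [alpha] contributes at most
   [e^(1/2) (1 - alpha^2)^((n-1)/2) < 4/3 (2 (1 - alpha))^((n-1)/2)]. This gives
   [K > (2 (1 - alpha))^(-(n-1)/2)].

   Only polynomials are averaged, so the rotation invariant mean is taken to be the Gaussian
   functional on polynomials, defined by its moments; no integral is needed. *)
Require Import Defs.
From HB Require Import structures.
From mathcomp Require Import all_boot all_order all_algebra.
From mathcomp Require Import all_classical all_reals all_analysis.
From mathcomp Require Import ring lra.
From mathcomp Require mpoly.
Import Order.TTheory GRing.Theory Num.Theory.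
Import numFieldNormedType.Exports.
Local Open Scope classical_set_scope.
Local Open Scope ring_scope.

Section GaussianMoments.
Variable R : realType.
Implicit Types (p g : {poly R}).

(* [gmom j] is the [j]-th moment of the standard normal law: [gauss p] is the Gaussian mean of [p]. *)
Fixpoint gmom (j : nat) : R :=
  match j with 0 => 1 | 1 => 0 | i.+2 => i.+1%:R * gmom i end.

Definition gauss p : R := \sum_(i < size p) p`_i * gmom i.

Lemma gaussE d p : (size p <= d)%N -> gauss p = \sum_(i < d) p`_i * gmom i.
Proof.
move=> sp; rewrite /gauss.
rewrite (big_ord_widen d (fun i => p`_i * gmom i) sp) big_mkcond /=.
by apply: eq_bigr => i _; case: ltnP => // ?; rewrite nth_default ?mul0r.
Qed.

Lemma gaussD p g : gauss (p + g) = gauss p + gauss g.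
Proof.
rewrite (gaussE _ _ (size_polyD p g)) (gaussE _ p (leq_maxl _ (size g))).
rewrite (gaussE _ g (leq_maxr (size p) _)) -big_split /=.
by apply: eq_bigr => i _; rewrite coefD mulrDl.
Qed.

Lemma gaussZ c p : gauss (c *: p) = c * gauss p.
Proof.
rewrite (gaussE _ _ (size_scale_leq c p)) /gauss mulr_sumr.
by apply: eq_bigr => i _; rewrite coefZ mulrA.
Qed.

Lemma gauss_sum (I : Type) (s : seq I) (F : I -> {poly R}) :
  gauss (\sum_(i <- s) F i) = \sum_(i <- s) gauss (F i).
Proof.
elim: s => [|i s IH]; first by rewrite !big_nil /gauss size_poly0 big_ord0.
by rewrite !big_cons gaussD IH.
Qed.

Lemma gaussXn j : gauss 'X^j = gmom j.
Proof.
rewrite /gauss size_polyXn big_ord_recr /= coefXn eqxx mul1r big1 ?add0r// => i _.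
by rewrite coefXn ltn_eqF ?mul0r.
Qed.

Lemma gaussC c : gauss c%:P = c.
Proof. by rewrite -[c%:P]mulr1 mul_polyC gaussZ -(expr0 'X) gaussXn mulr1. Qed.

Lemma gauss_stein p : gauss ('X * p) = gauss p^`().
Proof.
rewrite -[p]coefK poly_def mulr_sumr raddf_sum !gauss_sum; apply: eq_bigr => i _.
rewrite -[poly_deriv__canonical__Algebra_Additive _ _]/(_^`()) -scalerAr derivZ.
rewrite !gaussZ -exprS derivXn -scaler_nat gaussZ !gaussXn.
by case: (i : nat) => [|j] /=; rewrite ?mul0r.
Qed.

Lemma gauss_primitive p :
  exists g, p = (gauss p)%:P + ('X * g - g^`()).
Proof.
have [n] := ubnP (size p); elim: n => // n IH in p *; rewrite ltnS => sp.
have [q [c pE]] : exists q c, p = q * 'X + c%:P.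
  by elim/poly_ind: p {sp} => [|q c _]; [exists 0, 0; rewrite mul0r add0r | exists q, c].
have [q0|q0] := eqVneq q 0.
  by exists 0; rewrite pE q0 mul0r add0r gaussC mulr0 deriv0 subrr addr0.
have sq : (size q^`() < n)%N.
  rewrite (leq_trans (lt_size_deriv q0))//; apply: leq_trans sp.
  by rewrite pE size_MXaddC (negPf q0).
have [g gE] := IH _ sq; exists (q + g); rewrite pE.
have -> : gauss (q * 'X + c%:P) = gauss q^`() + c by rewrite gaussD gaussC mulrC gauss_stein.
rewrite derivD polyCD.
have -> : (gauss q^`())%:P = q^`() - ('X * g - g^`()) by rewrite {2}gE addrK.
ring.
Qed.

Lemma horner_bound g : exists C : R, forall x, 1 <= `|x| ->
  `|g.[x]| <= C * `|x| ^+ size g.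
Proof.
exists (\sum_(i < size g) `|g`_i|) => x x1.
rewrite horner_coef (le_trans (ler_norm_sum _ _ _))// mulr_suml ler_sum// => i _.
by rewrite normrM normrX ler_wpM2l// ler_weXn2l// ltnW.
Qed.

Lemma gaussian_decay g (e : R) : 0 < e ->
  exists2 y, 1 < y & forall x, `|x| = y -> `|g.[x] * expR (- (x ^+ 2 / 2))| < e.
Proof.
move=> e0; have [C gC] := horner_bound g; set d := size g in gC.
pose K : R := 2 ^+ d.+1 * d.+1`!%:R.
have K0 : 0 < K by rewrite mulr_gt0 ?exprn_gt0 ?ltr0n ?fact_gt0.
have C0 : 0 <= C.
  by have := gC 1; rewrite normr1 expr1n mulr1 lexx => /(_ isT); apply: le_trans.
pose y := 1 + (C * K + 1) / e.
have y1 : 1 < y by rewrite ltrDl divr_gt0// ltr_wpDl// mulr_ge0// ltW.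
have y0 : 0 < y by rewrite (lt_trans ltr01).
exists y => // x xy.
have x2 : x ^+ 2 = y ^+ 2 by rewrite -xy real_normK// num_real.
have E : y ^+ d.+1 / K <= expR (x ^+ 2 / 2).
  have x2ge0 : 0 <= x ^+ 2 / 2 by rewrite divr_ge0 ?sqr_ge0.
  apply: le_trans (expR_ge1Dxn d x2ge0); rewrite x2 ler_wpDl//.
    rewrite expr_div_n /K invfM mulrA ler_wpM2r ?invr_ge0 ?ler0n//.
    rewrite ler_wpM2r ?invr_ge0 ?exprn_ge0// lerXn2r ?nnegrE ?exprn_ge0 ?ltW//.
    by rewrite ltr_eXnr.
rewrite normrM (ger0_norm (expR_ge0 _)) expRN.
apply: (@le_lt_trans _ _ (C * y ^+ d / (y ^+ d.+1 / K))).
  apply: ler_pM; rewrite ?invr_ge0 ?expR_ge0 ?normr_ge0//.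
    by rewrite -xy gC// xy ltW.
  by rewrite lef_pV2 ?posrE ?expR_gt0 ?divr_gt0 ?exprn_gt0.
rewrite (_ : _ / _ = C * K / y); last by rewrite exprS; field; rewrite !gt_eqF ?exprn_gt0.
rewrite ltr_pdivrMr// /y mulrDr mulr1 [e * _]mulrC divfK ?gt_eqF//; lra.
Qed.

(* If [gauss p < 0 <= p], then [p - gauss p = 'X * g - g'] makes [g(x) exp(-x^2/2)]
   strictly decreasing on the line, although it vanishes at both ends. *)
Lemma gauss_ge0 p : (forall x, 0 <= p.[x]) -> 0 <= gauss p.
Proof.
move=> p0; rewrite leNgt; apply/negP => np; have [g pE] := gauss_primitive p.
have g0 x : g^`().[x] - x * g.[x] < 0.
  have := p0 x; rewrite pE !(hornerD,hornerN,hornerM,hornerX,hornerC); lra.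
pose F x := g.[x] * expR (- (x ^+ 2 / 2)).
have dF x : is_derive (x : R) (1 : R) F ((g^`().[x] - x * g.[x]) * expR (- (x ^+ 2 / 2))).
  by rewrite /F; apply: is_derive_eq; rewrite !scaler0 /GRing.scale /=; field.
have decF (x y : R) : x < y -> F y < F x.
  move=> xy; have cF : {within `[x, y], continuous F}.
    by apply: derivable_within_continuous => z _; exact: ex_derive.
  have [c _ cE] := MVT xy (fun z _ => dF z) cF.
  by rewrite -subr_lt0 cE pmulr_llt0 ?subr_gt0// pmulr_llt0 ?expR_gt0.
have F1 : 0 <= F 1.
  rewrite leNgt; apply/negP => Fn.
  have [|y y1 Fy] := @gaussian_decay g (- F 1); first by rewrite oppr_gt0.
  have := Fy y; rewrite gtr0_norm ?(lt_trans ltr01)// => /(_ erefl).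
  by rewrite ltr_norml opprK => /andP[+ _]; rewrite ltNge (ltW (decF _ _ y1)).
have F2 : F (- 1) <= 0.
  rewrite leNgt; apply/negP => Fn.
  have [y y1 Fy] := @gaussian_decay g (F (- 1)) Fn.
  have := Fy (- y); rewrite normrN gtr0_norm ?(lt_trans ltr01)// => /(_ erefl).
  rewrite ltr_norml => /andP[_]; rewrite ltNge ltW// decF//; lra.
have := decF (- 1) 1; lra.
Qed.
End GaussianMoments.

Section GaussianExpectation.
Import -(notations) mpoly.
Variables (R : realType) (n : nat).
Implicit Types (f g : mpoly n R) (i : 'I_n) (m : multinom n).

Definition expect f : R :=
  \sum_(m <- msupp f) mcoeff m f * \prod_(i < n) gmom R (m i).

Lemma expectE k f : (msize f <= k)%N ->
  expect f = \sum_(m : bmultinom n k) mcoeff (bmnm m) f * \prod_(i < n) gmom R (bmnm m i).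
Proof.
move=> fk; rewrite /expect (ssrcomplements.big_mksub (bmultinom n k)) ?msupp_uniq //=; last first.
  by move=> x /msize_mdeg_lt /leq_trans; apply.
by rewrite big_rmcond //= => j /memN_msupp_eq0 ->; rewrite mul0r.
Qed.

Lemma expect_is_linear : linear_for *%R expect.
Proof.
move=> c f g; pose k := maxn (msize (c *: f + g)) (maxn (msize f) (msize g)).
have [k1 k2 k3] : [/\ (msize (c *: f + g) <= k)%N, (msize f <= k)%N & (msize g <= k)%N].
  by rewrite !leq_max !leqnn ?orbT.
rewrite !(expectE k)// mulr_sumr -big_split /=; apply: eq_bigr => m _.
by rewrite linearP /= mulrDl mulrA.
Qed.

HB.instance Definition _ :=
  GRing.isLinear.Build R (mpoly n R) R *%R expect expect_is_linear.

Lemma expectXm m : expect (mpolyX R m) = \prod_(i < n) gmom R (m i).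
Proof. by rewrite /expect msuppX big_seq1 mcoeffX eqxx mul1r. Qed.

Lemma expect_stein i f : expect (mpolyX R (mnm1 i) * f) = expect (mderiv i f).
Proof.
elim/mpolyind: f => [|c m f _ _ IH]; first by rewrite mulr0 mderiv0 !linear0.
rewrite mulrDr mderivD !linearD /= IH; congr (_ + _).
rewrite -scalerAr mderivZ !linearZ /= mderivX linearZ /= -mpolyXD !expectXm.
congr (_ * _).
rewrite (bigD1 i)//= [in RHS](bigD1 i)//= mulrA mnmDE mnmBE mnm1E eqxx add1n subn1.
congr (_ * _); first by case: (m i) => [|j]; rewrite /= ?mul0r.
apply: eq_bigr => j ji; rewrite mnmDE mnmBE mnm1E eq_sym (negPf ji) add0n subn0//.
Qed.

(* The first [k] coordinates are integrated out. *)
Let partial_expect f (x : 'I_n -> R) (k : nat) : R :=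
  \sum_(m <- msupp f) mcoeff m f *
    \prod_(i < n) (if (i < k)%N then gmom R (m i) else x i ^+ m i).

Lemma expect_ge0 f : (forall x, 0 <= meval x f) -> 0 <= expect f.
Proof.
move=> f0; suff H k : (k <= n)%N -> forall x, 0 <= partial_expect f x k.
  have := H n (leqnn n) (fun=> 0); rewrite /partial_expect /expect.
  by under eq_bigr => m _ do under eq_bigr => i _ do rewrite ltn_ord.
elim: k => [_ x|k IH kn x].
  by have := f0 x; rewrite mevalE.
pose i0 := Ordinal kn.
pose c m := mcoeff m f * \prod_(i < n | i != i0) (if (i < k)%N then gmom R (m i) else x i ^+ m i).
pose p : {poly R} := \sum_(m <- msupp f) c m *: 'X^(m i0).
have -> : partial_expect f x k.+1 = gauss R p.
  rewrite gauss_sum; apply: eq_bigr => m _; rewrite gaussZ gaussXn /c.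
  rewrite (bigD1 i0)//= ltnSn -mulrA [_ * gmom _ _]mulrC; congr (_ * (_ * _)).
  apply: eq_bigr => i ii0; rewrite ltnS leq_eqVlt.
  by have /negPf -> : (i != k :> nat).
apply: gauss_ge0 => y.
have := IH (ltnW kn) (fun i => if i == i0 then y else x i).
rewrite /partial_expect horner_sum; congr (0 <= _); apply: eq_bigr => m _.
rewrite !hornerE /c (bigD1 i0)//= ltnn eqxx -mulrA [_ * y ^+ _]mulrC; congr (_ * (_ * _)).
by apply: eq_bigr => i /negPf ->.
Qed.

Definition linp (u : 'rV[R]_n) : mpoly n R := \sum_(i < n) u ord0 i *: mpolyX R (mnm1 i).
Definition sqp : mpoly n R := \sum_(i < n) mpolyX R (mnm1 i) ^+ 2.

Lemma meval_linp u (x : 'rV[R]_n) : meval (x ord0) (linp u) = dotv u x.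
Proof.
by rewrite /linp raddf_sum; apply: eq_bigr => i _; rewrite /= mevalZ mevalXU.
Qed.

Lemma meval_sqp (x : 'rV[R]_n) : meval (x ord0) sqp = dotv x x.
Proof.
by rewrite /sqp raddf_sum; apply: eq_bigr => i _; rewrite /= rmorphXn /= mevalXU expr2.
Qed.

Lemma mderivXU i j : mderiv i (mpolyX R (mnm1 j)) = (i == j)%:R.
Proof.
rewrite mderivX mnm1E eq_sym; case: eqP => [->|_]; last by rewrite scale0r.
rewrite scale1r (_ : mnm_sub _ _ = mnm0) ?mpolyX0//.
by apply/mnmP => k; rewrite mnmBE subnn mnmE.
Qed.

Lemma mderiv_linp u i : mderiv i (linp u) = (u ord0 i)%:A.
Proof.
rewrite /linp raddf_sum (bigD1 i)//= mderivZ mderivXU eqxx big1 ?addr0// => j ji.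
by rewrite mderivZ mderivXU eq_sym (negPf ji) scaler0.
Qed.

Lemma mderiv_exp f i k : mderiv i (f ^+ k) = k%:R * mderiv i f * f ^+ k.-1.
Proof.
elim: k => [|k IH]; first by rewrite expr0 mderivC !mul0r.
rewrite exprS mderivM IH; case: k {IH} => [|k] /=; first by rewrite expr0; ring.
rewrite !exprS -[in RHS]natr1; ring.
Qed.

Lemma mderiv_sqp i : mderiv i sqp = 2 * mpolyX R (mnm1 i).
Proof.
rewrite /sqp raddf_sum (bigD1 i)//= mderiv_exp mderivXU eqxx big1 ?addr0 ?mulr1// => j ji.
by rewrite mderiv_exp mderivXU eq_sym (negPf ji) mulr0 mul0r.
Qed.

Lemma expect_natl k f : expect (k%:R * f) = k%:R * expect f.
Proof. by rewrite !mulr_natl raddfMn. Qed.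

Lemma expect_sqp u k l :
  expect (sqp ^+ l.+1 * linp u ^+ k) = (n + 2 * l + k)%:R * expect (sqp ^+ l * linp u ^+ k).
Proof.
have -> : sqp ^+ l.+1 * linp u ^+ k =
    \sum_i mpolyX R (mnm1 i) * (mpolyX R (mnm1 i) * (sqp ^+ l * linp u ^+ k)).
  by rewrite exprS -mulrA {1}/sqp mulr_suml; apply: eq_bigr => i _; rewrite expr2 -!mulrA.
rewrite raddf_sum -expect_natl.
under eq_bigr => i _ do rewrite /= expect_stein.
rewrite -raddf_sum; congr expect.
have E i : mderiv i (mpolyX R (mnm1 i) * (sqp ^+ l * linp u ^+ k)) =
   sqp ^+ l * linp u ^+ k + mpolyX R (mnm1 i) ^+ 2 * (2 * l%:R * sqp ^+ l.-1 * linp u ^+ k)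
   + (u ord0 i *: mpolyX R (mnm1 i)) * (k%:R * sqp ^+ l * linp u ^+ k.-1).
  rewrite !mderivM !mderiv_exp mderiv_sqp mderiv_linp mderivXU eqxx.
  rewrite -[_ *: mpolyX _ _]mulr_algl mulr1n; move: (_%:A) => c; ring.
under eq_bigr => i _ do rewrite E.
rewrite !big_split /= sumr_const card_ord -!mulr_suml -/sqp -/(linp u) -[X in X + _ + _]mulr_natl.
have -> : (n + 2 * l + k)%:R = n%:R + 2 * l%:R + k%:R :> mpoly n R.
  by rewrite natrD natrD natrM.
case: l {E} => [|l]; case: k => [|k] /=; rewrite ?exprS; ring.
Qed.

Lemma expect_linp u k :
  expect (linp u ^+ k.+2) = k.+1%:R * dotv u u * expect (linp u ^+ k).
Proof.
have -> : linp u ^+ k.+2 =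
    \sum_i mpolyX R (mnm1 i) * (u ord0 i *: linp u ^+ k.+1).
  rewrite exprS {1}/linp mulr_suml; apply: eq_bigr => i _.
  by rewrite -scalerAl -scalerAr.
rewrite raddf_sum -mulrA /dotv mulr_suml mulr_sumr; apply: eq_bigr => i _ /=.
rewrite expect_stein mderivZ mderiv_exp mderiv_linp linearZ /= -mulrA expect_natl.
rewrite -scalerAl mul1r linearZ /=; ring.
Qed.

Lemma expect_sqp_linp u k l :
  expect (sqp ^+ l * linp u ^+ k) =
  \prod_(0 <= i < l) (n + 2 * i + k)%:R * expect (linp u ^+ k).
Proof.
elim: l => [|l IH]; first by rewrite big_geq// !mul1r.
by rewrite expect_sqp IH big_nat_recr//= mulrA [_ * _%:R]mulrC.
Qed.

Lemma expect1 : expect 1 = 1.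
Proof. by rewrite -mpolyX0 expectXm big1// => i _; rewrite mnmE. Qed.

Lemma expect_linp_even u k :
  expect (linp u ^+ (2 * k)) = dotv u u ^+ k * \prod_(0 <= i < k) (2 * i + 1)%:R.
Proof.
elim: k => [|k IH].
  by rewrite big_geq// mulr1 muln0 !expr0 expect1.
rewrite mulnS expect_linp IH big_nat_recr//= exprS -addn1; ring.
Qed.

Lemma expect_sqp_gt0 D : (0 < n)%N -> 0 < expect (sqp ^+ D).
Proof.
move=> n0; have := expect_sqp_linp 0 (2 * 0) D; rewrite muln0 mulr1 expect1 mulr1 => ->.
by rewrite prodr_gt0// => i _; rewrite ltr0n !addn_gt0 n0.
Qed.

Lemma expect_moment u k D : (0 < n)%N -> (k <= D)%N ->
  expect (sqp ^+ (D - k) * linp u ^+ (2 * k)) =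
  dotv u u ^+ k * (\prod_(0 <= i < k) ((2 * i + 1)%:R / (n + 2 * i)%:R)) *
  expect (sqp ^+ D).
Proof.
move=> n0 kD; have := expect_sqp_linp 0 (2 * 0) D; rewrite muln0 mulr1 expect1 mulr1 => ->.
rewrite expect_sqp_linp expect_linp_even prodf_div.
have -> : \prod_(0 <= i < D) (n + 2 * i + 0)%:R =
    \prod_(0 <= i < k) (n + 2 * i)%:R * \prod_(0 <= i < D - k) (n + 2 * i + 2 * k)%:R :> R.
  rewrite (big_cat_nat (leq0n k) kD) /=; congr (_ * _).
    by apply: eq_bigr => i _; rewrite addn0.
  rewrite -{1}[k]add0n big_addn; apply: eq_bigr => i _.
  by rewrite addn0 mulnDr addnA.
set B := \prod_(0 <= i < k) (n + 2 * i)%:R.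
have B0 : B != 0 by rewrite gt_eqF// prodr_gt0// => i _; rewrite ltr0n addn_gt0 n0.
by field.
Qed.
End GaussianExpectation.

Section SphereMoments.
Import -(notations) mpoly.
Variable R : realType.

(* The moment [E <x, u>^(2k)] of a unit vector [u], for [x] uniform on the unit sphere of R^n. *)
Definition sphere_moment (n k : nat) : R :=
  \prod_(0 <= i < k) ((2 * i + 1)%:R / (n + 2 * i)%:R).

Lemma sphere_moment_gt0 n k : (0 < n)%N -> 0 < sphere_moment n k.
Proof.
by move=> n0; apply: prodr_gt0 => i _; rewrite divr_gt0 ?ltr0n ?addn_gt0 ?n0 ?orbT.
Qed.

Lemma dotv_ge0 n (x : 'rV[R]_n) : 0 <= dotv x x.
Proof. by apply: sumr_ge0 => i _; rewrite -expr2 sqr_ge0. Qed.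

Lemma sqr_enorm n (x : 'rV[R]_n) : enorm x ^+ 2 = dotv x x.
Proof. by rewrite sqr_sqrtr ?dotv_ge0. Qed.

Lemma dotvNr n (u x : 'rV[R]_n) : dotv u (- x) = - dotv u x.
Proof. by rewrite -sumrN; apply: eq_bigr => i _; rewrite mxE mulrN. Qed.

Lemma enormN n (x : 'rV[R]_n) : enorm (- x) = enorm x.
Proof.
by rewrite /enorm; congr Num.sqrt; apply: eq_bigr => i _; rewrite !mxE mulrNN.
Qed.

Lemma enorm_gt0 n (x : 'rV[R]_n) : x != 0 -> 0 < enorm x.
Proof.
move=> x0; rewrite sqrtr_gt0 lt_neqAle dotv_ge0 andbT eq_sym.
apply: contra x0 => /eqP /psumr_eq0P xi0; apply/eqP/rowP => i; rewrite mxE.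
have := xi0 (fun j _ => sqr_ge0 (x ord0 j)) i isT.
by move/eqP; rewrite -expr2 sqrf_eq0 => /eqP.
Qed.

Lemma expect_cap n (u : 'rV[R]_n) c k D : (0 < n)%N -> dotv u u <= 1 -> 0 < c -> (k <= D)%N ->
  expect R n (c^-2 ^+ k *: (sqp R n ^+ (D - k) * linp R n u ^+ (2 * k))) <=
  sphere_moment n k / c ^+ (2 * k) * expect R n (sqp R n ^+ D).
Proof.
move=> n0 u1 c0 kD; rewrite linearZ /= expect_moment// !mulrA.
rewrite ler_wpM2r ?(ltW (expect_sqp_gt0 _ _ _ _))// -/(sphere_moment n k).
rewrite [X in _ <= X]mulrC exprVn -exprM ler_wpM2r ?(ltW (sphere_moment_gt0 _ _ _))//.
by rewrite ler_piMr ?invr_ge0 ?exprn_ge0 ?(ltW c0)// exprn_ile1 ?dotv_ge0.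
Qed.

Lemma cap_term_ge0 (c q l : R) k d : 0 <= q -> 0 <= c^-2 ^+ k * (q ^+ d * l ^+ (2 * k)).
Proof. by move=> q0; rewrite exprM !mulr_ge0// exprn_ge0// ?invr_ge0 sqr_ge0. Qed.

Lemma cap_indicators (c s l : R) k D : 0 < c -> 0 < s -> (k <= D)%N ->
  ((c * s <= l)%R%:R + (c * s <= - l)%R%:R) * (s ^+ 2) ^+ D <=
  c^-2 ^+ k * ((s ^+ 2) ^+ (D - k) * l ^+ (2 * k)).
Proof.
move=> c0 s0 kD; have cs0 : 0 < c * s by rewrite mulr_gt0.
have [C|C] := boolP ((c * s <= l) || (c * s <= - l)); last first.
  move: C; rewrite negb_or => /andP[/negPf -> /negPf ->]; rewrite addr0 mul0r.
  by rewrite cap_term_ge0// sqr_ge0.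
have -> : (c * s <= l)%R%:R + (c * s <= - l)%R%:R = 1 :> R.
  move: C; case: leP => c1; case: leP => c2 //= _; rewrite ?addr0 ?add0r//; lra.
rewrite mul1r -{1}(subnK kD) exprD mulrCA ler_wpM2l//; first by rewrite exprn_ge0 ?sqr_ge0.
have sl : (c * s) ^+ 2 <= l ^+ 2.
  rewrite -(real_normK (num_real l)) lerXn2r ?nnegrE ?normr_ge0 ?(ltW cs0)//.
  by rewrite ler_normr.
have h : 0 <= c^-2 * l ^+ 2 by rewrite -exprVn -exprMn sqr_ge0.
rewrite exprM -exprMn lerXn2r ?nnegrE ?sqr_ge0 ?h//.
by rewrite ler_pdivlMl ?exprn_gt0// -exprMn.
Qed.

(* Averages over the sphere the counting inequality obtained by covering both [x] and [-x]. *)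
Lemma cap_cover_count n K N (u : 'I_K -> 'rV[R]_n) (w : 'I_N -> 'rV[R]_n) (a t : R) k j :
  (0 < n)%N -> 0 < a -> 0 < t ->
  (forall i, dotv (u i) (u i) <= 1) -> (forall i, dotv (w i) (w i) <= 1) ->
  (forall x, x != 0 -> (exists i, a * enorm x <= dotv (u i) x) \/
                       (exists i, t * enorm x <= dotv (w i) x)) ->
  2 <= K%:R * (sphere_moment n k / a ^+ (2 * k)) + N%:R * (sphere_moment n j / t ^+ (2 * j)).
Proof.
move=> n0 a0 t0 u1 w1 cov; pose D := (k + j).+1.
have kD : (k <= D)%N by rewrite leqW// leq_addr.
have jD : (j <= D)%N by rewrite leqW// leq_addl.
pose f := \sum_(i < K) (a^-2 ^+ k *: (sqp R n ^+ (D - k) * linp R n (u i) ^+ (2 * k)))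
  + \sum_(i < N) (t^-2 ^+ j *: (sqp R n ^+ (D - j) * linp R n (w i) ^+ (2 * j))).
have E0 := expect_sqp_gt0 R n D n0.
suff : 2 * expect R n (sqp R n ^+ D) <= expect R n f.
  rewrite /f linearD /= !raddf_sum => H; rewrite -(ler_pM2r E0) (le_trans H)//.
  rewrite mulrDl lerD// -[X in X%:R]card_ord -sumr_const !mulr_suml ler_sum// => i _.
    by rewrite mul1r expect_cap.
  by rewrite mul1r expect_cap.
rewrite -subr_ge0 -expect_natl -linearB /=; apply: expect_ge0 => x0.
pose x : 'rV[R]_n := \row_i x0 i.
rewrite -(@meval_eq _ _ (x ord0) x0) => [|i]; last by rewrite mxE.
have mE c k' (v : 'rV[R]_n) : meval (x ord0) (c *: (sqp R n ^+ (D - k') * linp R n v ^+ (2 * k')))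
    = c * ((enorm x ^+ 2) ^+ (D - k') * dotv v x ^+ (2 * k')).
  by rewrite mevalZ rmorphM !rmorphXn /= meval_sqp meval_linp sqr_enorm.
rewrite mulr_natl mevalB mevalMn mevalD !raddf_sum /= rmorphXn /= meval_sqp -sqr_enorm.
under eq_bigr => i _ do rewrite mE.
under [X in _ + X - _]eq_bigr => i _ do rewrite mE.
rewrite subr_ge0; have [->|nx] := eqVneq x 0.
  have -> : enorm (0 : 'rV[R]_n) ^+ 2 = 0.
    by rewrite sqr_enorm /dotv big1// => i _; rewrite mxE mul0r.
  have -> : (0 : R) ^+ D = 0 by rewrite expr0n.
  rewrite mul0rn.
  by rewrite addr_ge0// sumr_ge0// => i _; rewrite cap_term_ge0.
have s0 := enorm_gt0 _ _ nx; set s := enorm x in s0 *.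
pose ind (y : 'rV[R]_n) : R := \sum_(i < K) (a * s <= dotv (u i) y)%R%:R +
  \sum_(i < N) (t * s <= dotv (w i) y)%R%:R.
have ind1 y : y != 0 -> enorm y = s -> 1 <= ind y.
  move=> y0 ys; rewrite /ind; case: (cov y y0) => -[i]; rewrite ys => iy.
    by rewrite (bigD1 i)//= iy -addrA lerDl addr_ge0// sumr_ge0.
  by rewrite addrC (bigD1 i)//= iy -addrA lerDl addr_ge0// sumr_ge0.
have i1 := ind1 x nx erefl; have i2 := ind1 (- x).
rewrite oppr_eq0 enormN in i2; have {}i2 := i2 nx erefl.
apply: (@le_trans _ _ ((ind x + ind (- x)) * (s ^+ 2) ^+ D)).
  by rewrite -[X in X <= _]mulr_natl ler_wpM2r ?exprn_ge0 ?sqr_ge0//; lra.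
rewrite /ind addrACA -!big_split mulrDl !mulr_suml; apply: lerD; apply: ler_sum => i _.
  by rewrite dotvNr cap_indicators.
by rewrite dotvNr cap_indicators.
Qed.

End SphereMoments.

Section SphereMomentBounds.
Variable R : realType.
Implicit Types (a c w L : R).

Lemma prod_odd j : \prod_(0 <= i < j) (2 * i + 1)%:R = (2 * j)`!%:R / (2 ^+ j * j`!%:R) :> R.
Proof.
elim: j => [|j IH]; first by rewrite big_geq// !(muln0, expr0, fact0, mul1r, invr1).
rewrite big_nat_recr//= IH mulnS 2!factS factS !natrM exprS.
have -> : (2 * j).+2%:R = 2 * j.+1%:R :> R by rewrite -natrM mulnS.
rewrite addn1; field.
by rewrite pnatr_eq0 -lt0n fact_gt0 nat1r pnatr_eq0 expf_neq0 // pnatr_eq0.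
Qed.

Lemma sphere_moment_le n j : (0 < n)%N ->
  sphere_moment R n j <= (2 * j)`!%:R / (2 ^+ j * j`!%:R) / n%:R ^+ j.
Proof.
move=> n0; rewrite -prod_odd /sphere_moment prodf_div ler_wpM2l ?prodr_ge0//.
have H : n%:R ^+ j <= \prod_(0 <= i < j) (n + 2 * i)%:R :> R.
  rewrite -[j in X in X <= _]subn0 -prodr_const_nat ler_prod// => i _.
  by rewrite ler0n ler_nat leq_addr.
by rewrite lef_pV2 ?posrE ?exprn_gt0 ?ltr0n// (lt_le_trans _ H)// exprn_gt0 ?ltr0n.
Qed.

Lemma exp_series_le (x : R) m : 0 <= x -> \sum_(i < m) x ^+ i / i`!%:R <= expR x.
Proof.
move=> x0; rewrite /expR -(big_mkord xpredT (fun i => x ^+ i / i`!%:R)).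
apply: (@nondecreasing_cvgn_le _ (series (exp_coeff x))).
  by apply/nondecreasing_seqP => k; rewrite seriesSr lerDl; apply: exp_coeff_ge0.
exact: is_cvg_series_exp_coeff.
Qed.

Lemma cosh_series_le (y M : R) : 0 <= y ->
  (forall J, \sum_(j < J) y ^+ (2 * j) / (2 * j)`!%:R <= M) -> expR y + expR (- y) <= 2 * M.
Proof.
move=> y0 H.
have cv x : series (exp_coeff x) @ \oo --> expR x by exact: is_cvg_series_exp_coeff.
have cs : (fun m => series (exp_coeff y) m + series (exp_coeff (- y)) m) @ \oo -->
   expR y + expR (- y).
  by apply: cvgD; exact: cv.
rewrite -(cvg_lim _ cs)//; apply: limr_le; first by apply/cvg_ex; eexists; exact: cs.
apply: nearW => m.
rewrite (_ : _ + _ = 2 * \sum_(j < uphalf m) y ^+ (2 * j) / (2 * j)`!%:R).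
  by rewrite ler_pM2l.
rewrite /series /= -big_split /=.
elim: m => [|m IH]; first by rewrite big_geq// big_ord0 mulr0.
rewrite big_nat_recr//= IH /exp_coeff /= exprNn -signr_odd.
have := odd_double_half m; rewrite uphalf_half -mul2n.
case: (odd m) => /= mE; last by rewrite big_ord_recr /= !add0n in mE *; rewrite mE expr0; ring.
by rewrite add1n expr1; ring.
Unshelve. all: by end_near.
Qed.

(* If the inequality failed for every [j], comparing termwise the series of [expR (2 * L)] and [cosh (4 * L)]
   would give [cosh (4 * L) <= expR (4 * L) / 2]. *)
Lemma exists_tail_moment n L : (0 < n)%N -> 0 < L ->
  exists j, sphere_moment R n j <= 2 * expR (- (2 * L)) * (4 * L / n%:R) ^+ j.
Proof.
move=> n0 L0; apply: contrapT => /forallNP H.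
have {}H j : (4 * L) ^+ (2 * j) / (2 * j)`!%:R <= expR (2 * L) / 2 * ((2 * L) ^+ j / j`!%:R).
  have := H j; move/negP; rewrite -ltNge => /lt_le_trans /(_ (sphere_moment_le n j n0)) /ltW.
  have A0 : 0 < (2 * j)`!%:R :> R by rewrite ltr0n fact_gt0.
  have B0 : 0 < j`!%:R :> R by rewrite ltr0n fact_gt0.
  have E0 : 0 < expR (2 * L) by exact: expR_gt0.
  have n0' : 0 < n%:R ^+ j :> R by rewrite exprn_gt0 ?ltr0n.
  have P0 : 0 < (2 * L) ^+ j by rewrite exprn_gt0 ?mulr_gt0.
  have T0 : 0 < 2 ^+ j :> R by rewrite exprn_gt0.
  rewrite exprMn exprVn [X in X <= _]mulrA ler_pM2r ?invr_gt0// expRN.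
  have -> : (4 * L) ^+ (2 * j) = (2 ^+ j * (2 * L) ^+ j) ^+ 2.
    by rewrite -exprMn -exprM mulnC; congr (_ ^+ _); ring.
  have -> : (4 * L) ^+ j = 2 ^+ j * (2 * L) ^+ j by rewrite -exprMn; congr (_ ^+ _); ring.
  move: A0 B0 E0 P0 T0.
  move: (_`!%:R) (_`!%:R) (expR _) (_ ^+ j) (_ ^+ j) => A B E P T A0 B0 E0 P0 T0 HA.
  rewrite ler_pdivrMr// -(ler_pM2l (_ : 0 < 2 / (E * T * P))); last first.
    by rewrite divr_gt0// !mulr_gt0.
  rewrite (_ : _ * (P * T) ^+ 2 = 2 / E * (P * T)); last by field; rewrite !gt_eqF.
  by rewrite (le_trans HA)// le_eqVlt; apply/orP; left; apply/eqP; field; rewrite !gt_eqF.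
have S J : \sum_(j < J) (4 * L) ^+ (2 * j) / (2 * j)`!%:R <= expR (4 * L) / 2.
  apply: (@le_trans _ _ (expR (2 * L) / 2 * \sum_(j < J) (2 * L) ^+ j / j`!%:R)).
    by rewrite mulr_sumr ler_sum.
  rewrite (_ : 4 * L = 2 * L + 2 * L); last by ring.
  rewrite expRD mulrAC ler_wpM2r ?invr_ge0// ler_wpM2l ?expR_ge0// exp_series_le//.
  by rewrite mulr_ge0// ltW.
have := cosh_series_le _ _ _ S; have := expR_gt0 (- (4 * L)).
have L4 : 0 <= 4 * L by rewrite mulr_ge0// ltW.
by move=> ? /(_ L4); lra.
Qed.

Lemma artanh_chord c w : 0 < c <= 1 -> 0 < w < 1 ->
  ln ((1 + c * w) / (1 - c * w)) <= c * ln ((1 + w) / (1 - w)).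
Proof.
move=> /andP[c0 c1] /andP[w0 w1].
pose G x : R := c * (ln (1 + x) - ln (1 - x)) - (ln (1 + c * x) - ln (1 - c * x)).
pose dG x : R := c * ((1 + x)^-1 + (1 - x)^-1) - (c / (1 + c * x) + c / (1 - c * x)).
have dGE x : x \in `]-1, 1[ -> is_derive (x : R) (1 : R) G (dG x).
  rewrite in_itv /= => /andP[x1 x2]; rewrite /G.
  have h1 : 0 < 1 + x by lra.
  have h2 : 0 < 1 - x by lra.
  have h3 : 0 < 1 + c * x by nra.
  have h4 : 0 < 1 - c * x by nra.
  have d1 := is_derive1_ln h1; have d2 := is_derive1_ln h2.
  have d3 := is_derive1_ln h3; have d4 := is_derive1_ln h4.
  apply: is_derive_eq. by rewrite /dG /GRing.scale /=; ring.
have dG' x : x \in `]0, w[ -> is_derive (x : R) (1 : R) G (dG x).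
  by rewrite in_itv /= => /andP[? ?]; apply: dGE; rewrite in_itv /=; lra.
have cG : {within `[0, w], continuous G}.
  apply: derivable_within_continuous => z; rewrite in_itv /= => /andP[? ?].
  have zi : z \in `]-1, 1[ by rewrite in_itv /=; lra.
  by have := dGE z zi => ?; exact: ex_derive.
have [x xw E] := MVT w0 dG' cG.
move: xw; rewrite in_itv /= => /andP[x0 xw].
have cx : c * x <= x by rewrite ler_piMl// ltW.
have cw : c * w <= w by rewrite ler_piMl// ltW.
have cx0 : 0 < c * x by rewrite mulr_gt0.
have cw0 : 0 < c * w by rewrite mulr_gt0.
have dG0 : 0 <= dG x.
  have x1 : x < 1 by exact: lt_trans w1.
  have -> : dG x = 2 * c * ((1 - x ^+ 2)^-1 - (1 - (c * x) ^+ 2)^-1).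
    by rewrite /dG; field; rewrite !gt_eqF//; nra.
  rewrite mulr_ge0 ?mulr_ge0 ?(ltW c0)// subr_ge0 lef_pV2 ?posrE; nra.
have G0 : G 0 = 0 by rewrite /G mulr0 !addr0 !subr0 ln1; ring.
have : 0 <= G w by rewrite G0 !subr0 in E; rewrite E mulr_ge0// ltW.
rewrite /G !ln_div ?posrE; lra.
Qed.


Lemma unimodal_min (z m p q a v : R) : 0 <= z -> 0 <= m -> 0 < p -> q < 1 -> p <= a <= q ->
  v <= z * ln p + m * ln (1 - p) -> v <= z * ln q + m * ln (1 - q) ->
  v <= z * ln a + m * ln (1 - a).
Proof.
move=> z0 m0 p0 q1 /andP[pa aq] vp vq; rewrite leNgt; apply/negP => va.
have a0 : 0 < a by lra.
have a1 : 0 < 1 - a by lra.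
have lnB (x y : R) : 0 < x -> 0 < y -> ln x - ln y <= (x - y) / y.
  move=> x0 y0; rewrite -ln_div// -{1}[x](subrK y) mulrDl divff ?gt_eqF// addrC.
  by rewrite le_ln1Dx// mulrBl divff ?gt_eqF// ltrBrDl subrr divr_gt0.
have S (x : R) : 0 < x -> x < 1 -> z * ln a + m * ln (1 - a) < z * ln x + m * ln (1 - x) ->
    0 < (x - a) * (z / a - m / (1 - a)).
  move=> x0 x1 lt; have h1 := lnB x a x0 a0; have h2 := lnB (1 - x) (1 - a) _ a1.
  have {}h2 : ln (1 - x) - ln (1 - a) <= (1 - x - (1 - a)) / (1 - a) by apply: h2; lra.
  have := ler_wpM2l z0 h1; have := ler_wpM2l m0 h2.
  rewrite (_ : (x - a) * (z / a - m / (1 - a)) =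
    z * ((x - a) / a) + m * ((1 - x - (1 - a)) / (1 - a))); last by ring.
  lra.
have Sp := S p p0 _ (lt_le_trans va vp); have Sq := S q _ q1 (lt_le_trans va vq).
have {}Sp : 0 < (p - a) * (z / a - m / (1 - a)) by apply: Sp; lra.
have {}Sq : 0 < (q - a) * (z / a - m / (1 - a)) by apply: Sq; lra.
have [k0|k0] := leP 0 (z / a - m / (1 - a)).
  by have := mulr_le0_ge0 (_ : p - a <= 0) k0; lra.
by have := mulr_ge0_le0 (_ : 0 <= q - a) (ltW k0); lra.
Qed.

(* At [a = cap_node n k] the bounds [sphere_moment n k / a ^+ k] and
   [sphere_moment n k.+1 / a ^+ k.+1] on the measure of a cap coincide. *)
Definition cap_node (n k : nat) : R := (2 * k + 1)%:R / (n + 2 * k)%:R.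

Lemma cap_node_itv n k : (1 < n)%N -> 0 < cap_node n k < 1.
Proof.
move=> n1; have h : 0 < (n + 2 * k)%:R :> R by rewrite ltr0n addn_gt0 (ltnW n1).
apply/andP; split; first by rewrite /cap_node divr_gt0 ?h// ltr0n addn1.
by rewrite /cap_node ltr_pdivrMr// mul1r ltr_nat addnC ltn_add2r.
Qed.

Lemma cap_nodeE n k : cap_node n k = (2 * k%:R + 1) / (n%:R + 2 * k%:R).
Proof. by rewrite /cap_node natrD [(n + _)%:R]natrD natrM. Qed.

Lemma sphere_momentS n k : sphere_moment R n k.+1 = sphere_moment R n k * cap_node n k.
Proof. by rewrite /sphere_moment big_nat_recr. Qed.

Lemma cap_node_step n k : (1 < n)%N ->
  k.+1%:R * ln (cap_node n k) + (n%:R - 1) / 2 * ln (1 - cap_node n k) <=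
  k.+1%:R * ln (cap_node n k.+1) + (n%:R - 1) / 2 * ln (1 - cap_node n k.+1).
Proof.
move=> n1; set m : R := (n%:R - 1) / 2; have n1' : 1 < n%:R :> R by rewrite (ltr_nat _ 1).
pose z : R := k.+1%:R; have z1 : 1 <= z by rewrite (ler_nat _ 1).
have aE : cap_node n k = (2 * z - 1) / (2 * (z + m) - 1).
  rewrite cap_nodeE /z /m -natr1; congr (_ / _); by field.
have aE' : cap_node n k.+1 = (2 * z + 1) / (2 * (z + m) + 1).
  rewrite cap_nodeE /z /m; congr (_ / _); by field.
have m0 : 0 < m by rewrite /m divr_gt0// subr_gt0.
have cE : 1 - (2 * z - 1) / (2 * (z + m) - 1) = 2 * m / (2 * (z + m) - 1).
  by field; rewrite gt_eqF//; lra.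
have cE' : 1 - (2 * z + 1) / (2 * (z + m) + 1) = 2 * m / (2 * (z + m) + 1).
  by field; rewrite gt_eqF//; lra.
rewrite aE aE' cE cE' -/z !ln_div ?posrE; try lra.
have := artanh_chord (z / (z + m)) (1 / (2 * z)).
rewrite ler_pdivrMr ?ltr_pdivrMr ?divr_gt0//; try lra.
rewrite !mul1r => /(_ _ _)/wrap[]; [lra|lra|].
rewrite (_ : z / (z + m) * (2 * z)^-1 = (2 * (z + m))^-1); last by field; rewrite !gt_eqF//; lra.
have fr (y : R) : 1 <= y ->
    ln ((1 + (2 * y)^-1) / (1 - (2 * y)^-1)) = ln (2 * y + 1) - ln (2 * y - 1).
  move=> y1; rewrite -ln_div ?posrE; [|lra|lra]; congr ln; field.
  by rewrite !gt_eqF//; lra.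
rewrite !fr; [|lra|lra].
rewrite mulrAC ler_pdivlMr; last lra.
lra.
Qed.

Lemma sphere_moment_node n k : (1 < n)%N ->
  ln (sphere_moment R n k) <=
    1 / 2 + k%:R * ln (cap_node n k) + (n%:R - 1) / 2 * ln (1 - cap_node n k).
Proof.
move=> n1; set m : R := (n%:R - 1) / 2; have n1' : 1 < n%:R :> R by rewrite (ltr_nat _ 1).
elim: k => [|k IH].
  rewrite /sphere_moment big_geq// ln1 mul0r addr0 /cap_node addn0 muln0 add0n.
  have -> : 1 - 1%:R / n%:R = (n%:R / (n%:R - 1))^-1 :> R by field; rewrite !gt_eqF//; lra.
  rewrite lnV ?posrE ?divr_gt0//; try lra.
  have -> : n%:R / (n%:R - 1) = 1 + (n%:R - 1)^-1 :> R by field; rewrite gt_eqF//; lra.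
  have h : ln (1 + (n%:R - 1)^-1 : R) <= (n%:R - 1)^-1.
    by apply: le_ln1Dx; rewrite (lt_trans (_ : -1 < 0 :> R))// ?invr_gt0; lra.
  have := ler_wpM2l (_ : 0 <= m) h.
  have -> : m / (n%:R - 1) = 1 / 2 by rewrite /m; field; rewrite gt_eqF//; lra.
  have m0 : 0 <= m by rewrite /m divr_ge0// subr_ge0 ltW.
  by move=> /(_ m0); rewrite mulrN; lra.
have := cap_node_step n k n1; rewrite -/m /= => st.
have /andP[a0 a1] := cap_node_itv n k n1.
rewrite sphere_momentS lnM ?posrE ?(sphere_moment_gt0 R n k (ltnW n1))//.
by rewrite -natr1 in st *; lra.
Qed.

Lemma exists_cap_moment n a : (1 < n)%N -> 0 < a < 1 ->
  exists k, sphere_moment R n k <= expR (1 / 2) * a ^+ k * (1 - a) `^ ((n%:R - 1) / 2).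
Proof.
move=> n1 /andP[a0 a1]; set m := (n%:R - 1) / 2.
have n1' : 1 < n%:R :> R by rewrite (ltr_nat _ 1).
have m0 : 0 <= m by rewrite /m divr_ge0// subr_ge0 ltW.
suff [k Hk] : exists k, ln (sphere_moment R n k) <= 1 / 2 + k%:R * ln a + m * ln (1 - a).
  exists k; have Mk := sphere_moment_gt0 R n k (ltnW n1).
  have a1' : 0 < 1 - a by lra.
  rewrite -ler_ln ?posrE// ?mulr_gt0 ?expR_gt0 ?exprn_gt0 ?powR_gt0//.
  rewrite !lnM ?posrE// ?mulr_gt0 ?expR_gt0 ?exprn_gt0 ?powR_gt0// expRK ln_powR lnXn//.
  by rewrite -[ln a *+ k]mulr_natl.
have ex : exists k, a <= cap_node n k.
  have ca : 0 <= (n%:R + 1) / (1 - a) by rewrite divr_ge0//; lra.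
  have := archi_boundP ca; set k := Num.bound _; rewrite ltr_pdivrMr => [kP|]; last lra.
  exists k; rewrite cap_nodeE ler_pdivlMr.
    have : 0 <= k%:R * (1 - a) by rewrite mulr_ge0//; lra.
    nra.
  by rewrite ltr_pwDl// ?mulr_ge0//; lra.
case: (ex_minnP ex) => -[|k] ak kmin.
  exists 0; apply: le_trans (sphere_moment_node n 0 n1) _; rewrite mul0r -/m.
  have /andP[_ h] := cap_node_itv n 0 n1.
  by rewrite mul0r lerD2l ler_wpM2l// ler_ln ?posrE//; lra.
have ka : cap_node n k <= a.
  by rewrite leNgt; apply/negP => /ltW /kmin; rewrite ltnn.
exists k.+1; have := sphere_moment_node n k n1; have H1 := sphere_moment_node n k.+1 n1.
have /andP[b0 b1] := cap_node_itv n k n1; have /andP[_ c1] := cap_node_itv n k.+1 n1.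
rewrite -/m /= in H1 * => H0.
have := @unimodal_min k.+1%:R m _ _ a (ln (sphere_moment R n k.+1) - 1 / 2) (ler0n _ _) m0 b0 c1.
rewrite ka ak => /(_ isT) H.
rewrite -addrA -lerBlDl; apply: H; last by rewrite lerBlDl addrA.
rewrite lerBlDl addrA sphere_momentS lnM ?posrE ?(sphere_moment_gt0 R n k (ltnW n1))//.
rewrite -[k.+1%:R]natr1; lra.
Qed.

End SphereMomentBounds.

Section PolarVertices.
Variables (R : realType) (n : nat).
Implicit Types (a d u v x z : 'rV[R]_n).

Lemma dotvC u v : dotv u v = dotv v u.
Proof. by apply: eq_bigr => i _; rewrite mulrC. Qed.

Lemma dotvDr u v x : dotv u (v + x) = dotv u v + dotv u x.
Proof. by rewrite -big_split; apply: eq_bigr => i _; rewrite mxE mulrDr. Qed.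

Lemma dotvZr u c v : dotv u (c *: v) = c * dotv u v.
Proof. by rewrite mulr_sumr; apply: eq_bigr => i _; rewrite mxE mulrCA. Qed.

Lemma dotvDl u v x : dotv (v + x) u = dotv v u + dotv x u.
Proof. by rewrite !(dotvC _ u) dotvDr. Qed.

Lemma dotvZl u c v : dotv (c *: v) u = c * dotv v u.
Proof. by rewrite !(dotvC _ u) dotvZr. Qed.

Lemma dotvBr u v x : dotv u (v - x) = dotv u v - dotv u x.
Proof. by rewrite dotvDr dotvNr. Qed.

Lemma dotvBZ u v e :
  dotv (u - e *: v) (u - e *: v) = dotv u u - 2 * e * dotv u v + e ^+ 2 * dotv v v.
Proof. by rewrite -scaleNr !(dotvDl, dotvDr, dotvZl, dotvZr) (dotvC v u); ring. Qed.

Lemma dotv_sumr u (I : finType) (F : I -> 'rV[R]_n) :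
  dotv u (\sum_i F i) = \sum_i dotv u (F i).
Proof.
elim/big_ind2: _ => //; last by move=> x1 x2 y1 y2 <- <-; rewrite dotvDr.
by rewrite /dotv big1// => i _; rewrite mxE mulr0.
Qed.

Lemma dotvE u v : dotv u v = (u *m v^T) ord0 ord0.
Proof. by rewrite mxE; apply: eq_bigr => i _; rewrite mxE. Qed.

Lemma enormZ c x : enorm (c *: x) = `|c| * enorm x.
Proof.
by rewrite /enorm dotvZr dotvZl mulrA -expr2 sqrtrM ?sqr_ge0// sqrtr_sqr.
Qed.

Lemma enorm0 : enorm (0 : 'rV[R]_n) = 0.
Proof. by rewrite -(scale0r 0) enormZ normr0 mul0r. Qed.

Lemma dotv_gt0 x : x != 0 -> 0 < dotv x x.
Proof. by move=> x0; rewrite -sqr_enorm exprn_gt0// enorm_gt0. Qed.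

Variables (m : nat) (V : 'I_m -> 'rV[R]_n).

Lemma conv_hull_le a c x : (forall i, dotv a (V i) <= c) -> conv_hull V x -> dotv a x <= c.
Proof.
move=> ac [w [w0 [w1 ->]]]; rewrite dotv_sumr -[c]mul1r -w1 mulr_suml.
by apply: ler_sum => i _; rewrite dotvZr ler_wpM2l.
Qed.

Lemma conv_hull_vertex i : conv_hull V (V i).
Proof.
exists (fun j => (j == i)%:R); split=> [j|]; first by rewrite ler0n.
rewrite (bigD1 i)//= eqxx big1 => [|j /negPf ->//]; rewrite addr0; split=> //.
by rewrite (bigD1 i)//= eqxx scale1r big1 ?addr0// => j /negPf ->; rewrite scale0r.
Qed.

Definition active_rows a : 'M[R]_(m, n) :=
  \matrix_(i < m) (if dotv a (V i) == 1 then V i else 0).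

Definition polar_vertex a : Prop :=
  (forall i, dotv a (V i) <= 1) /\ \rank (active_rows a) = n.

Lemma polar_vertex_basis a : polar_vertex a ->
  exists2 f : 'I_n -> 'I_m, row_free (\matrix_(i < n) V (f i)) & forall i, dotv a (V (f i)) = 1.
Proof.
move=> [_ rk].
have rf : row_full (active_rows a) by rewrite -col_leq_rank rk.
have fr : row_free (rowsub (fullrankfun rf) (active_rows a)).
  by rewrite -row_leq_rank (eqP (fullrowsub_full rf)).
have act i : dotv a (V (fullrankfun rf i)) = 1.
  apply/eqP; apply: contraT => /negPf ai.
  have : row i (rowsub (fullrankfun rf) (active_rows a)) = 0.
    by rewrite row_rowsub rowK ai.
  move/eqP; rewrite rowE mulmx_free_eq0// => /eqP/matrixP/(_ 0 i)/eqP.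
  by rewrite !mxE !eqxx oner_eq0.
exists (fullrankfun rf) => //; move: fr; congr row_free.
by apply/row_matrixP => i; rewrite row_rowsub !rowK act eqxx.
Qed.

Variable r : R.
Hypothesis r0 : 0 < r.
Hypothesis ball : forall x, enorm x <= 1 -> conv_hull V (r *: x).

Lemma support_ball d c : (forall i, dotv d (V i) <= c) -> r * enorm d <= c.
Proof.
move=> dc; have [d0|d0] := eqVneq d 0.
  have := conv_hull_le _ _ _ dc (ball 0 _); rewrite scaler0 d0.
  by rewrite enorm0 mulr0 dotvE mul0mx mxE; apply.
have e0 := enorm_gt0 _ _ _ d0.
have := conv_hull_le _ _ _ dc (ball ((enorm d)^-1 *: d) _).
rewrite !dotvZr -sqr_enorm expr2 mulKf ?gt_eqF//; apply.
by rewrite enormZ gtr0_norm ?invr_gt0// mulVf ?gt_eqF.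
Qed.

Lemma polar_unit a : (forall i, dotv a (V i) <= 1) -> dotv (r *: a) (r *: a) <= 1.
Proof.
move=> /support_ball ra; rewrite dotvZr dotvZl mulrA -expr2 -sqr_enorm -exprMn.
by rewrite exprn_ile1// mulr_ge0 ?sqrtr_ge0// ltW.
Qed.

(* Unless its active constraints span, [a] moves along a direction orthogonal to them until a new
   constraint becomes active. *)
Lemma polar_vertex_ge x a : (forall i, dotv a (V i) <= 1) ->
  exists2 b, polar_vertex b & dotv a x <= dotv b x.
Proof.
have [k] := ubnP (n - \rank (active_rows a)); elim: k => // k IH in a *.
rewrite ltnS => rk fa; have [rn|rn] := eqVneq (\rank (active_rows a)) n.
  by exists a.
have rlt : (\rank (active_rows a) < n)%N by rewrite ltn_neqAle rn rank_leq_col.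
have [d d0 [da dx]] : exists2 d, d != 0 & (active_rows a *m d^T = 0 /\ 0 <= dotv d x).
  have : kermx (active_rows a)^T != 0 by rewrite kermx_eq0 /row_free mxrank_tr.
  move=> /rowV0Pn[v /sub_kermxP va v0].
  have {}va : active_rows a *m v^T = 0 by rewrite -[LHS]trmxK trmx_mul trmxK va trmx0.
  have [vx|vx] := leP 0 (dotv v x); first by exists v.
  exists (- v); first by rewrite oppr_eq0.
  by rewrite linearN mulmxN va oppr0 dotvC dotvNr oppr_ge0 dotvC ltW.
have dact i : dotv a (V i) = 1 -> dotv d (V i) = 0.
  move=> ai; have /matrixP/(_ i 0) := da; rewrite !mxE => <-.
  by apply: eq_bigr => j _; rewrite !mxE ai eqxx mulrC.
have [i0 i0P] : exists i, 0 < dotv d (V i).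
  apply: contrapT => /forallNP H.
  have := support_ball d 0 (fun i => _); rewrite leNgt mulr_gt0 ?enorm_gt0// => /(_ _)/wrap[]//.
  by move=> i; rewrite leNgt; apply/negP/H.
pose q i := (1 - dotv a (V i)) / dotv d (V i).
case: (@arg_minP _ _ _ i0 (fun i => 0 < dotv d (V i)) q i0P) => i1 i1P i1min.
pose b := a + q i1 *: d.
have bE i : dotv b (V i) = dotv a (V i) + q i1 * dotv d (V i) by rewrite dotvDl dotvZl.
have q0 : 0 <= q i1 by rewrite divr_ge0 ?subr_ge0// ltW.
have fb i : dotv b (V i) <= 1.
  rewrite bE; have [di|di] := ltP 0 (dotv d (V i)).
    by have := i1min i di; rewrite {2}/q ler_pdivlMr//; lra.
  by rewrite (le_trans _ (fa i))// gerDl mulr_ge0_le0.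
have act1 : dotv b (V i1) = 1 by rewrite bE /q divfK ?gt_eqF//; lra.
have sub : (active_rows a < active_rows b)%MS.
  have row_b i : dotv b (V i) = 1 -> (V i <= active_rows b)%MS.
    by move=> bi; have := row_sub i (active_rows b); rewrite rowK bi eqxx.
  rewrite ltmxE; apply/andP; split.
    apply/row_subP => i; rewrite rowK; case: eqP => [ai|_]; last exact: sub0mx.
    by apply: row_b; rewrite bE dact// mulr0 addr0.
  apply/negP => /(submx_trans (row_b _ act1)) /submxP[D VD].
  by move: i1P; rewrite dotvC dotvE VD -mulmxA da mulmx0 mxE ltxx.
have [||c pc bc] := IH b.
- by rewrite (leq_trans _ rk)// ltn_sub2l// rank_ltmx.
- exact: fb.
exists c => //; apply: le_trans bc.
by rewrite dotvDl dotvZl lerDl mulr_ge0.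
Qed.

Definition simplex : set 'rV[R]_m := [set w | (forall i, 0 <= w ord0 i) /\ \sum_i w ord0 i = 1].

Lemma sum_continuous (U : topologicalType) (I : Type) (s : seq I) (F : I -> U -> R) :
  (forall i, continuous (F i)) -> continuous (fun w => \sum_(i <- s) F i w).
Proof.
move=> cF; apply: continuous_big => [|i _]; last exact: cF.
exact: add_continuous.
Qed.

Lemma simplex_compact : compact simplex.
Proof.
have cube : compact [set v : 'rV[R]_m | forall i, v ord0 i \in `[0, 1]].
  by apply: (@rV_compact R m (fun=> `[0, 1]%classic)) => _; apply: segment_compact.
apply: subclosed_compact cube _ => [|w [w0 w1] i]; last first.
  rewrite in_itv /= w0 -w1 (bigD1 i)//= lerDl sumr_ge0//.
have -> : simplex = \bigcap_(i in [set: 'I_m]) [set w : 'rV[R]_m | 0 <= w ord0 i] `&`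
    [set w | \sum_i w ord0 i = 1].
  apply/seteqP; split=> w [w0 w1]; split=> // i; first by move=> _; exact: w0.
  exact: (w0 i I).
apply: closedI.
  apply: closed_bigI => i _.
  apply: (@preimage_closed _ _ (fun w : 'rV[R]_m => w ord0 i) [set x | 0 <= x]).
    by move=> *; exact: coord_continuous.
  exact: closed_ge.
apply: (@preimage_closed _ _ (fun w : 'rV[R]_m => \sum_i w ord0 i) [set x | x = 1]).
  by move=> *; apply: sum_continuous => i; exact: coord_continuous.
exact: closed_eq.
Qed.

Lemma polar_separation z : ~ conv_hull V z ->
  exists2 a, (forall i, dotv a (V i) <= 1) & 1 < dotv a z.
Proof.
move=> nz.
pose comb (w : 'rV[R]_m) : 'rV[R]_n := \sum_i w ord0 i *: V i.
have hull w : simplex w -> conv_hull V (comb w) by move=> [w0 w1]; exists (fun i => w ord0 i).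
have [w sw wmin] : exists2 w, simplex w &
    forall v : 'rV[R]_m, simplex v ->
      dotv (z - comb w) (z - comb w) <= dotv (z - comb v) (z - comb v).
  have [w0 [w0P [w1 _]]] : conv_hull V (r *: 0).
    by apply: ball; rewrite enorm0.
  have ne : simplex !=set0.
    exists (\row_i w0 i); split=> [i|]; first by rewrite mxE.
    by rewrite -w1; apply: eq_bigr => i _; rewrite mxE.
  pose f (w : 'rV[R]_m) := dotv (z - comb w) (z - comb w).
  have cf : continuous f.
    rewrite /f /dotv; apply: sum_continuous => k.
    have ck : continuous (fun w : 'rV[R]_m => (z - comb w) ord0 k).
      have -> : (fun w : 'rV[R]_m => (z - comb w) ord0 k) =
        (fun w => z ord0 k - \sum_i w ord0 i * V i ord0 k).
        apply/funext => w; rewrite !mxE summxE; congr (_ - _).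
        by apply: eq_bigr => i _; rewrite mxE.
      have cs : continuous (fun w : 'rV[R]_m => \sum_i w ord0 i * V i ord0 k).
        apply: sum_continuous => i v.
        by apply: (cvgM (@coord_continuous R 1 m ord0 i v) (cvg_cst _)).
      by move=> w; apply: (cvgB (cvg_cst _) (cs w)).
    by move=> w; apply: (cvgM (ck w) (ck w)).
  have [w wS wmin] := EVT_min_rV ne simplex_compact (continuous_subspaceT cf).
  exists w; first exact: set_mem.
  by move=> v sv; apply: wmin; apply: mem_set.
pose y := comb w; pose d := z - y.
have d0 : d != 0.
  apply/eqP => /eqP; rewrite subr_eq0 => /eqP zy; apply: nz; rewrite zy; exact: hull.
have dV i : dotv d (V i) <= dotv d y.
  rewrite leNgt; apply/negP => lt; pose g := V i - y.
  have g0 : 0 < dotv d g by rewrite dotvBr subr_gt0.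
  have E e : 0 <= e <= 1 -> dotv d d <= dotv (d - e *: g) (d - e *: g).
    move=> /andP[e0 e1]; pose v : 'rV[R]_m := \row_j ((1 - e) * w ord0 j + e * (j == i)%:R).
    have sv : simplex v.
      split=> [j|]; first by rewrite mxE addr_ge0 ?mulr_ge0 ?ler0n ?subr_ge0//; case: sw.
      under eq_bigr do rewrite mxE.
      rewrite big_split /= -!mulr_sumr (proj2 sw) (bigD1 i)//= eqxx big1 => [|j /negPf ->//].
      by rewrite mulr1n; ring.
    have -> : d - e *: g = z - comb v.
      have -> : comb v = (1 - e) *: y + e *: V i; last first.
        by rewrite /d /g; apply/rowP => k; rewrite !mxE; ring.
      rewrite /comb /y /comb scaler_sumr.
      under eq_bigr => j _ do rewrite mxE scalerDl -!scalerA.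
      rewrite big_split /=; congr (_ + _); rewrite -scaler_sumr (bigD1 i)//= eqxx scale1r.
      by rewrite big1 ?addr0// => j /negPf ->; rewrite scale0r.
    exact: wmin.
  have gg : 0 <= dotv g g by exact: dotv_ge0.
  pose e := dotv d g / (dotv g g + dotv d g).
  have e0 : 0 < e by rewrite divr_gt0// ltr_wpDl.
  have e1 : e <= 1 by rewrite ler_pdivrMr ?ltr_wpDl// mul1r lerDr.
  have := E e; rewrite (ltW e0) e1 => /(_ isT).
  rewrite dotvBZ.
  have eg : e * (dotv g g + dotv d g) = dotv d g by rewrite /e divfK// gt_eqF// ltr_wpDl.
  nra.
have c0 : 0 < dotv d y by rewrite (lt_le_trans _ (support_ball _ _ dV))// mulr_gt0 ?enorm_gt0.
exists ((dotv d y)^-1 *: d) => [i|]; first by rewrite dotvZl ler_pdivrMl// mulr1.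
rewrite dotvZl ltr_pdivlMl// mulr1 -subr_gt0 -dotvBr; exact: dotv_gt0.
Qed.
End PolarVertices.

Section PolytopeFacets.
Variables (R : realType) (n : nat) (P : set 'rV[R]_n.+1) (r : R).
Hypotheses (polyP : is_polytope P) (r0 : 0 < r).
Hypothesis ballP : forall x : 'rV[R]_n.+1, enorm x <= 1 -> P (r *: x).

Let facet_of (a : 'rV[R]_n.+1) : set 'rV[R]_n.+1 := [set x | P x /\ dotv a x = 1].

Lemma facet_normals : exists K (a : 'I_K -> 'rV[R]_n.+1),
  [/\ injective (facet_of \o a), forall i, is_facet P (facet_of (a i)),
      forall i, dotv (r *: a i) (r *: a i) <= 1 &
      forall x, x != 0 -> exists i, 0 < dotv (a i) x /\ P ((dotv (a i) x)^-1 *: x)].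
Proof.
have [m [V PE]] := polyP.
have ballV x : enorm x <= 1 -> conv_hull V (r *: x) by rewrite -PE; exact: ballP.
pose M (f : {ffun 'I_n.+1 -> 'I_m}) : 'M[R]_n.+1 := \matrix_i V (f i).
pose sol f : 'rV[R]_n.+1 := (invmx (M f) *m const_mx 1)^T.
pose good f := (M f \in unitmx) && [forall i, dotv (sol f) (V i) <= 1].
pose S := undup [seq sol f | f <- enum {ffun 'I_n.+1 -> 'I_m} & good f].
have solP f a : M f \in unitmx -> (forall i, dotv a (V (f i)) = 1) -> a = sol f.
  move=> uf fa; rewrite /sol; have -> : const_mx 1 = M f *m a^T.
    by apply/colP => i; rewrite !mxE -(fa i); apply: eq_bigr => j _; rewrite !mxE mulrC.
  by rewrite mulKmx// trmxK.
have solE f : M f \in unitmx -> forall i, dotv (sol f) (V (f i)) = 1.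
  move=> uf i; have /colP/(_ i) := mulKVmx uf (const_mx 1 : 'cV[R]__).
  by rewrite [RHS]mxE => <-; rewrite dotvC dotvE !mxE; apply: eq_bigr => j _; rewrite !mxE.
have S_vertex a : polar_vertex _ _ _ V a -> a \in S.
  move=> pa; have [f fr fa] := polar_vertex_basis _ _ _ _ _ pa.
  have ME : M (finfun f) = \matrix_i V (f i) by apply/matrixP => i j; rewrite !mxE ffunE.
  have uf : M (finfun f) \in unitmx by rewrite -row_free_unit ME.
  have aE : a = sol (finfun f) by apply: solP => // i; rewrite ffunE.
  rewrite mem_undup; apply/mapP; exists (finfun f) => //.
  rewrite mem_filter mem_enum andbT /good uf /=; apply/forallP => i.
  by rewrite -aE; case: pa.
have SP a : a \in S -> exists2 f, M f \in unitmx &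
    (forall i, dotv a (V i) <= 1) /\ (forall i, dotv a (V (f i)) = 1).
  rewrite mem_undup => /mapP[f]; rewrite mem_filter => /andP[/andP[uf /forallP lef] _] ->.
  by exists f => //; split=> //; exact: solE.
exists (size S), (fun i => tnth (in_tuple S) i); split.
- have Sinj : injective (tnth (in_tuple S)) by apply/tuple_uniqP; exact: undup_uniq.
  move=> i j /= E; apply: Sinj.
  have [f uf [_ ef]] := SP _ (mem_tnth i (in_tuple S)).
  rewrite (solP _ _ uf ef); apply/esym/solP => // k.
  have : facet_of (tnth (in_tuple S) i) (V (f k)).
    by split; [rewrite PE; exact: conv_hull_vertex | exact: ef].
  by move: E; rewrite /= => -> [].
- move=> i; have [f uf [lef ef]] := SP _ (mem_tnth i (in_tuple S)).
  set a := tnth _ _ in lef ef *.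
  exists a, 1; split.
  + apply/eqP => a0; have := ef ord0; rewrite a0 dotvE mul0mx mxE => /eqP.
    by rewrite eq_sym oner_eq0.
  + by move=> x; rewrite PE; exact: conv_hull_le.
  + by [].
  + exists (V (f ord0)), (fun i => V (f (lift ord0 i))); split.
    * by split; [rewrite PE; exact: conv_hull_vertex | exact: ef].
    * by move=> k; split; [rewrite PE; exact: conv_hull_vertex | exact: ef].
    * apply: inj_row_free => v v0.
      pose w : 'rV[R]_n.+1 := 
        \row_i (if unlift ord0 i is Some k then v ord0 k else - \sum_k v ord0 k).
      have w0 : w *m M f = 0.
        rewrite -[RHS]v0 !mulmx_sum_row big_ord_recl mxE unlift_none rowK scaleNr scaler_suml.
        rewrite addrC -sumrB; apply: eq_bigr => k _.
        by rewrite mxE liftK !rowK scalerBr.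
      have {}w0 : w = 0 by rewrite -(mulmxK uf w) w0 mul0mx.
      by apply/rowP => k; have /rowP/(_ (lift ord0 k)) := w0; rewrite !mxE liftK.
- by move=> i; have [f _ [lef _]] := SP _ (mem_tnth i (in_tuple S)); exact: (polar_unit _ _ _ V).
- move=> x x0.
  have ex0 : exists a, (forall i, dotv a (V i) <= 1) /\ 0 < dotv a x.
    pose s := 1 + \sum_i `|dotv x (V i)|.
    have s0 : 0 < s by rewrite ltr_pwDl// sumr_ge0.
    exists (s^-1 *: x); split=> [i|]; last by rewrite dotvZl mulr_gt0 ?invr_gt0 ?dotv_gt0.
    rewrite dotvZl ler_pdivrMl// mulr1 /s (bigD1 i)//=.
    by rewrite (le_trans (ler_norm _))// addrCA lerDl addr_ge0// sumr_ge0.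
  have [a [lea ax]] := ex0; have [b /S_vertex bS ab] := polar_vertex_ge _ _ _ V r r0 ballV x a lea.
  have [i0 bi0] : exists i, b = tnth (in_tuple S) i by apply/tnthP.
  case: (@arg_maxP _ _ _ i0 xpredT (fun i => dotv (tnth (in_tuple S) i) x) isT) => i _ imax.
  set c := tnth _ i in imax *; exists i.
  have c0 : 0 < dotv c x by rewrite (lt_le_trans ax)// (le_trans ab)// bi0; exact: (imax i0 isT).
  split=> //; rewrite PE; apply: contrapT => /(polar_separation _ _ _ V r r0 ballV)[a' lea'].
  rewrite dotvZr ltr_pdivlMl// mulr1; apply/negP; rewrite -leNgt.
  have [b' /S_vertex b'S ab'] := polar_vertex_ge _ _ _ V r r0 ballV x a' lea'.
  have [j bj] : exists j, b' = tnth (in_tuple S) j by apply/tnthP.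
  rewrite bj in ab'.
  by rewrite (le_trans ab')//; exact: (imax j isT).
Qed.

End PolytopeFacets.

Section CoveredPolytope.
Variable R : realType.

(* [|z - c| <= 1] and [<c, z> <= t |c| |z|] give
   [1 >= |z|^2 - 2 t |c| |z| + |c|^2 >= (1 - t^2) |z|^2]. *)
Lemma covered_norm_le n N (c : 'I_N -> 'rV[R]_n) (z : 'rV[R]_n) t : 0 <= t < 1 ->
  (exists i, enorm (z - c i) <= 1) ->
  (forall i, dotv ((enorm (c i))^-1 *: c i) z < t * enorm z) ->
  Num.sqrt (1 - t ^+ 2) * enorm z <= 1.
Proof.
move=> /andP[t0 t1] [i zc] ang; set p := enorm (c i).
have cz : dotv (c i) z <= t * p * enorm z.
  have [c0|c0] := eqVneq (c i) 0.
    by rewrite /p c0 enorm0 mulr0 mul0r dotvE mul0mx mxE.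
  have p0 : 0 < p by exact: enorm_gt0.
  by have := ltW (ang i); rewrite dotvZl ler_pdivrMl// mulrA (mulrC p).
have : enorm (z - c i) ^+ 2 <= 1 by rewrite exprn_ile1// sqrtr_ge0.
have -> : enorm (z - c i) ^+ 2 = enorm z ^+ 2 - 2 * dotv (c i) z + p ^+ 2.
  have := dotvBZ R n z (c i) 1; rewrite scale1r -!sqr_enorm -/p => ->.
  by rewrite dotvC; ring.
move=> H; have e0 : 0 <= enorm z by exact: sqrtr_ge0.
have s0 : 0 <= 1 - t ^+ 2 by rewrite subr_ge0 exprn_ile1// ltW.
rewrite -(@ler_pXn2r _ 2)// ?nnegrE ?mulr_ge0 ?sqrtr_ge0//.
rewrite exprMn sqr_sqrtr// expr1n; have := sqr_ge0 (p - t * enorm z); nra.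
Qed.

Lemma expR_sixth : expR (1 / 6 : R) <= 6 / 5.
Proof.
have := expR_ge1Dx (- (1 / 6) : R); rewrite expRN; move: (expR_gt0 (1 / 6 : R)).
by move: (expR _) => e e0; rewrite -(ler_pM2r e0) mulVf ?gt_eqF//; lra.
Qed.

Lemma expR1_le3 : expR (1 : R) <= 3.
Proof.
have -> : (1 : R) = 6%:R * (1 / 6) by field.
rewrite expRM_natl; apply: (@le_trans _ _ ((6 / 5) ^+ 6)); last lra.
by rewrite lerXn2r ?nnegrE ?expR_ge0 ?divr_ge0// expR_sixth.
Qed.

Lemma cap_bound_lt n (r L : R) : (3 <= n)%N -> 0 < r <= 1 -> 1 <= L -> L < n%:R / 8 ->
  expR (1 / 2) * (1 - (r * Num.sqrt (1 - 4 * L / n%:R)) ^+ 2) `^ ((n%:R - 1) / 2) <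
  4 / 3 * (2 * (1 - r * Num.sqrt (1 - 4 * L / n%:R))) `^ ((n%:R - 1) / 2).
Proof.
move=> n3 /andP[r0 r1] L1 L8; set a := r * _; have n3' : 3 <= n%:R :> R by rewrite (ler_nat _ 3).
have n0 : 0 < n%:R :> R by lra.
set m := (n%:R - 1) / 2; have m0 : 0 <= m by rewrite /m divr_ge0//; lra.
pose y := L / n%:R; have y0 : 0 < y by rewrite divr_gt0//; lra.
have y8 : y < 1 / 8 by rewrite /y ltr_pdivrMr//; lra.
have aE : a = r * Num.sqrt (1 - 4 * y) by rewrite /a /y mulrA.
have s1 : Num.sqrt (1 - 4 * y) <= 1 - 2 * y.
  rewrite -[X in _ <= X]ger0_norm -?sqrtr_sqr ?ler_wsqrtr//; [nra | lra].
have s0 : 0 <= Num.sqrt (1 - 4 * y) by exact: sqrtr_ge0.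
have a0 : 0 <= a by rewrite aE mulr_ge0// ltW.
have ay : a <= 1 - 2 * y by rewrite aE; nra.
have Q0 : 0 < (2 * (1 - a)) `^ m by rewrite powR_gt0//; lra.
have -> : 1 - a ^+ 2 = (2 * (1 - a)) * ((1 + a) / 2) by field.
rewrite powRM; [|lra|lra].
rewrite mulrCA [X in _ < X]mulrC ltr_pM2l//.
have h1 : ((1 + a) / 2) `^ m <= expR (- (y * m)).
  rewrite -mulNr expRM ge0_ler_powR// ?nnegrE ?expR_ge0//; first lra.
  by apply: le_trans (expR_ge1Dx _); lra.
apply: (@le_lt_trans _ _ (expR (1 / 2) * expR (- (y * m)))).
  by rewrite ler_wpM2l ?expR_ge0.
rewrite -expRD; apply: (@le_lt_trans _ _ (expR (1 / 6))); last first.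
  by apply: le_lt_trans expR_sixth _; lra.
rewrite ler_expR.
have -> : y * m = L * ((1 - n%:R^-1) / 2) by rewrite /y /m; field; rewrite gt_eqF.
have : n%:R^-1 <= 3^-1 :> R by rewrite lef_pV2 ?posrE.
nra.
Qed.

End CoveredPolytope.

Theorem theorem1p1 (R : realType) (n : nat) (P : set 'rV[R]_n) (r : R) (N : nat) :
  (3 <= n)%N ->
  is_polytope P ->
  3 * Num.sqrt 3 / Num.sqrt (n%:R) <= r -> r <= 1 ->
  (forall x : 'rV[R]_n, enorm x <= 1 -> P (r *: x)) ->
  is_covering_number P (@unit_ball R n) N ->
  (3 <= N)%N -> (N%:R : R) < expR (n%:R / 8 : R) ->
  more_facets_than P
    ((2 * (1 - r * Num.sqrt (1 - 4 * ln (N%:R : R) / n%:R)))^-1 `^ ((n%:R - 1) / 2)).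
Proof.
case: n P => [//|n] P n3 polyP rlow r1 ballP [[c cov] _] N3 Nexp.
have n0 : 0 < n.+1%:R :> R by rewrite ltr0n.
have r0 : 0 < r.
  by apply: lt_le_trans rlow; rewrite divr_gt0 ?mulr_gt0 ?sqrtr_gt0.
have N0 : 0 < N%:R :> R by rewrite ltr0n (leq_trans _ N3).
set L := ln (N%:R : R).
have NL : N%:R = expR L by rewrite lnK.
have L1 : 1 <= L.
  by rewrite -(expRK 1) ler_ln ?posrE ?expR_gt0// (le_trans (expR1_le3 _))// ler_nat.
have L8 : L < n.+1%:R / 8 by rewrite -ltr_expR -NL.
have [K [a [a_inj a_facet a_norm a_exit]]] := facet_normals R n P r polyP r0 ballP.
pose t := Num.sqrt (4 * L / n.+1%:R).
have t2 : t ^+ 2 = 4 * L / n.+1%:R by rewrite sqr_sqrtr// divr_ge0 ?mulr_ge0//; lra.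
have t2' : t ^+ 2 < 1.
  by rewrite t2 ltr_pdivrMr//; move: L8; rewrite ltr_pdivlMr//; lra.
have t0 : 0 < t by rewrite sqrtr_gt0 divr_gt0// mulr_gt0//; lra.
have t1 : t < 1 by rewrite -(@ltr_pXn2r _ 2)// ?nnegrE ?ltW// expr1n.
pose al := r * Num.sqrt (1 - 4 * L / n.+1%:R).
have sq0 : 0 < Num.sqrt (1 - 4 * L / n.+1%:R) by rewrite sqrtr_gt0 subr_gt0 -t2.
have al0 : 0 < al by rewrite mulr_gt0.
have al1 : al < 1.
  rewrite /al -[X in _ < X]mulr1 (le_lt_trans (ler_piMl (ltW sq0) r1))// mulr1.
  rewrite -[X in _ < X]sqrtr1 ltr_sqrt// gtrDl oppr_lt0 divr_gt0// mulr_gt0//; lra.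
have w1 (i : 'I_N) : dotv ((enorm (c i))^-1 *: c i) ((enorm (c i))^-1 *: c i) <= 1.
  rewrite -sqr_enorm enormZ; have [->|c0] := eqVneq (c i) 0; first by rewrite enorm0 mulr0 expr0n.
  have e0 := enorm_gt0 R _ _ c0.
  by rewrite gtr0_norm ?invr_gt0// mulVf ?gt_eqF// expr1n.
have cover x : x != 0 -> (exists i, al * enorm x <= dotv (r *: a i) x) \/
    (exists i, t * enorm x <= dotv ((enorm (c i))^-1 *: c i) x).
  move=> x0; have [i [ax Pz]] := a_exit x x0; set mu := dotv (a i) x in ax Pz.
  have [w|/forallNP nw] := pselect (exists i, t * enorm x <= dotv ((enorm (c i))^-1 *: c i) x).
    by right.
  left; exists i; rewrite dotvZl /al -mulrA ler_pM2l// -t2 -/mu.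
  have ez : enorm (mu^-1 *: x) = mu^-1 * enorm x by rewrite enormZ gtr0_norm ?invr_gt0.
  suff : Num.sqrt (1 - t ^+ 2) * enorm (mu^-1 *: x) <= 1.
    by rewrite ez mulrCA ler_pdivrMl// mulr1.
  apply: (covered_norm_le R n.+1 N c).
  - by rewrite ltW.
  - have [j _ [y y1 yz]] := cov _ Pz; exists j; rewrite -yz addrC addKr; exact: y1.
  - move=> j; rewrite dotvZr ez mulrCA ltr_pM2l ?invr_gt0// ltNge; apply/negP/nw.
have [j tail] := exists_tail_moment R n.+1 L (ltn0Sn n) (lt_le_trans ltr01 L1).
have [|k cap] := exists_cap_moment R n.+1 (al ^+ 2) (ltnW n3).
  by rewrite exprn_gt0//= expr_lt1// ltW.
have key := cap_cover_count R n.+1 K N (fun i => r *: a i) (fun i => (enorm (c i))^-1 *: c i)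
  al t k j (ltn0Sn n) al0 t0 a_norm w1 cover.
have num : expR (1 / 2) * (1 - al ^+ 2) `^ ((n.+1%:R - 1) / 2) <
    4 / 3 * (2 * (1 - al)) `^ ((n.+1%:R - 1) / 2).
  by apply: cap_bound_lt => //; rewrite r0.
exists K, (fun i => [set x | P x /\ dotv (a i) x = 1]); split => //.
rewrite -/L -/al.
set Q := (2 * (1 - al)) `^ _ in num.
have B0 : 0 < 2 * (1 - al) by rewrite mulr_gt0// subr_gt0.
have Q0 : 0 < Q by rewrite powR_gt0.
have -> : (2 * (1 - al))^-1 `^ ((n.+1%:R - 1) / 2) = Q^-1.
  apply: (mulIf (lt0r_neq0 Q0)); rewrite mulVf ?gt_eqF// /Q -powRM ?invr_ge0 ?(ltW B0)//.
  by rewrite mulVf ?powR1// gt_eqF.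
have tail' : N%:R * (sphere_moment R n.+1 j / t ^+ (2 * j)) <= 2 / 3.
  apply: (@le_trans _ _ (N%:R * (2 * expR (- (2 * L))))).
    by rewrite ler_wpM2l ?ler0n// ler_pdivrMr ?exprn_gt0// exprM t2.
  have -> : expR (- (2 * L)) = (N%:R * N%:R)^-1 by rewrite NL -expRD -expRN; congr expR; ring.
  have -> : N%:R * (2 / (N%:R * N%:R)) = 2 / N%:R :> R by field; rewrite gt_eqF.
  by rewrite ler_wpM2l// lef_pV2 ?posrE// ler_nat.
have cap' : sphere_moment R n.+1 k / al ^+ (2 * k) < 4 / 3 * Q.
  apply: le_lt_trans num; rewrite ler_pdivrMr ?exprn_gt0// (le_trans cap)// exprM.
  by rewrite mulrAC.
rewrite -[X in X < _]mul1r ltr_pdivrMr// mulrC.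
have [K0|K0] := posnP K; first by move: key tail'; rewrite K0 mul0r; lra.
have {}K0 : 0 < K%:R :> R by rewrite ltr0n.
have := cap'; rewrite -(ltr_pM2l K0) => H.
by move: key tail' H; set X := K%:R * _; lra.
Qed.
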